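(* Let $2\le k<n$ be integers, let $G=([n],E,w)$ be a weighted graph, and let $F=[f_1,\dots,f_n]\in\mathbb{R}_+^{r\times n}$ be an (entrywise non-negative) feature matrix associated with $G$. Suppose there exists a set $I\subset[n]$ which is feature-dominating, i.e. $|I|=k-1$ and $$f_i\ \ge_{\mathrm{cw}}\ \sum_{j\notin I}f_j\qquad\text{for every } i\in I.$$ Then the Max-$k$-Cut SDP on $G$ is exact.
   Context: $[n]=\{1,\dots,n\}$; $\mathbb{S}^n$ is the space of real symmetric $n\times n$ matrices; $X\succeq0$ means positive semidefinite; $\mathbb{R}_+$ denotes the non-negative reals. For $x,y\in\mathbb{R}^r$, $x\ge_{\mathrm{cw}}y$ means $x_p\ge y_p$ for every coordinate $p\in[r]$. A matrix $F=[f_1,\dots,f_n]\in\mathbb{R}^{r\times n}$ is a feature matrix associated with $G$ if its columns satisfy $w_{ij}=f_i^\top f_j$ for every $i\ne j$ (with $w_{ij}=0$ if $ij\notin E$). Max-$k$-Cut on $G$: partition $[n]$ into $k$ disjoint (possibly empty) parts $A_1,\dots,A_k$ so as to maximize $\operatorname{Cut}(A_1,\dots,A_k)=\sum_{\ell<m}\sum_{i\in A_\ell,\,j\in A_m}w_{ij}$. The Max-$k$-Cut SDP (Frieze--Jerrum relaxation) on $G$ is to maximize $\frac{k-1}{k}\sum_{i<j}w_{ij}(1-X_{ij})$ over $X\in\mathbb{S}^n$ subject to $X_{ii}=1$ for all $i$, $X_{ij}\ge-\frac{1}{k-1}$ for all $i\ne j$, and $X\succeq0$. The SDP is exact on $G$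 if its optimal value equals the optimal value of Max-$k$-Cut on $G$. *)

(* Defs.v *)
(* MathComp world; the real numbers are an arbitrary [R : realType]. *)
From HB Require Import structures.
From mathcomp Require Export all_boot all_order all_algebra.
From mathcomp Require Export all_classical all_reals all_analysis.

Set Implicit Arguments.
Unset Strict Implicit.
Unset Printing Implicit Defensive.

Import Order.TTheory GRing.Theory Num.Theory.

Local Open Scope ring_scope.

(* Simple graph on n vertices (numbered from 0) with arbitrary real edge
   weights; the weight function is extended by 0 to all non-adjacent pairs. *)
Record wgraph (R : realType) (n : nat) := WGraph {
  edge : rel 'I_n ;
  edge_sym : symmetric edge ;
  edge_irr : irreflexive edge ;
  weight : 'I_n -> 'I_n -> R ;
  weight_sym : forall i j, weight i j = weight j i ;
  weight_nonedge : forall i j, ~~ edge i j -> weight i j = 0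
}.

Section Defs.
Variables (R : realType) (n : nat).
Implicit Types (G : wgraph R n) (X : 'M[R]_n) (k r : nat).

(* Only the off-diagonal entries of F^T F are prescribed. *)
Definition feature_matrix r G (F : 'M[R]_(r, n)) : Prop :=
  forall i j, i != j -> weight G i j = ((col i F)^T *m col j F) 0 0.

Definition ge_cw r (x y : 'cV[R]_r) : Prop := forall p, y p 0 <= x p 0.

Definition feature_dominating r k (F : 'M[R]_(r, n)) (I : {set 'I_n}) : Prop :=
  #|I| = k.-1 /\
  forall i, i \in I -> ge_cw (col i F) (\sum_(j | j \notin I) col j F).

(* The parts are ordered and possibly empty, so [finset.partition], which
   excludes the empty set, does not apply. *)
Definition kpartition k (A : 'I_k -> {set 'I_n}) : Prop :=
  (forall l m, l != m -> [disjoint A l & A m]) /\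
  (\bigcup_(l < k) A l)%SET = [set: 'I_n]%SET.

Definition cut k G (A : 'I_k -> {set 'I_n}) : R :=
  \sum_(l < k) \sum_(m < k | (l < m)%N)
    \sum_(i in A l) \sum_(j in A m) weight G i j.

Definition max_cut_value k G : \bar R :=
  ereal_sup [set (cut G A)%:E | A in @kpartition k]%classic.

Definition psdmx X : Prop :=
  X \is symmetricmx /\ forall x : 'cV[R]_n, 0 <= (x^T *m X *m x) 0 0.

Definition sdp_feasible k X : Prop :=
  [/\ forall i, X i i = 1,
      forall i j, i != j -> - (k%:R - 1)^-1 <= X i j
    & psdmx X].

Definition sdp_objective k G X : R :=
  (k%:R - 1) / k%:R *
  \sum_(i < n) \sum_(j < n | (i < j)%N) weight G i j * (1 - X i j).

Definition sdp_value k G : \bar R :=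
  ereal_sup [set (sdp_objective k G X)%:E | X in sdp_feasible k]%classic.

Definition sdp_exact k G : Prop := sdp_value k G = max_cut_value k G.

End Defs.

(* Main.v *)
(** Let [J] be the complement of [I] and consider the partition into [J] and
    the singletons [{i}], [i] in [I].  Since [w] is a sum over the rows [a] of
    [F] of the rank-one weights [a i * a j], it is enough to bound the SDP
    objective by this cut for a single row.  There, with [s] the sum of [a] over
    [J] and [Y i j = X i j + 1/(k-1) >= 0], the defect is a combination of
    products [a i * a j] with nonnegative coefficients, except inside [J].
    Feature domination [s <= a i] therefore allows replacing [a i] by [s] for
    every [i] in [I], after which the defect is the value of the quadratic form
    [X] at a vector, hence nonnegative. *)
Require Import Defs.
From mathcomp Require Import ring.

Set Implicit Arguments.
Unset Strict Implicit.
Unset Printing Implicit Defensive.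

Import Order.TTheory GRing.Theory Num.Theory.
Local Open Scope ring_scope.

(** * Symmetric double sums, quadratic forms and a Cauchy-Schwarz inequality *)

Section Sums.
Variable R : realType.

Lemma sum_lt_symmetric n (h : 'I_n -> 'I_n -> R) :
  (forall i j, h i j = h j i) ->
  (\sum_(i < n) \sum_(j < n | (i < j)%N) h i j) *+ 2 =
  \sum_i \sum_j (i != j)%:R * h i j.
Proof.
move=> hC; rewrite mulr2n.
under eq_bigr do rewrite big_mkcond.
rewrite {2}exchange_big -big_split; apply: eq_bigr => i _.
rewrite -big_split; apply: eq_bigr => j _ /=.
by rewrite -val_eqE /= (hC j i); case: ltngtP => _ /=;
  rewrite ?mul0r ?mul1r ?addr0 ?add0r.
Qed.

Lemma quad_formE n (X : 'M[R]_n) (x : 'cV[R]_n) :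
  (x^T *m X *m x) 0 0 = \sum_i \sum_j x i 0 * x j 0 * X i j.
Proof.
rewrite mxE exchange_big /=; apply: eq_bigr => j _.
by rewrite mxE mulr_suml; apply: eq_bigr => i _; rewrite !mxE mulrAC.
Qed.

(** Nonnegativity of the variance: the squared deviations of [s] from its mean [S / k] sum to
    [(k * Q - S ^+ 2) / k]. *)
Lemma sqr_sum_le k (s : 'I_k -> R) :
  (\sum_l s l) ^+ 2 <= k%:R * \sum_l s l ^+ 2.
Proof.
case: k s => [|k] s; first by rewrite !big_ord0 mulr0 expr0n.
set S := \sum_l s l; set Q := \sum_l _.
have k0 : 0 < k.+1%:R :> R by rewrite ltr0n.
have : 0 <= \sum_l (s l - S / k.+1%:R) ^+ 2 by apply: sumr_ge0 => l _; exact: sqr_ge0.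
under eq_bigr do rewrite sqrrB.
rewrite big_split sumrB sumrMnl -mulr_suml -/S -/Q sumr_const card_ord /=.
rewrite (_ : _ + _ = (k.+1%:R * Q - S ^+ 2) / k.+1%:R).
  by rewrite pmulr_lge0 ?invr_gt0 // subr_ge0.
rewrite -[_ *+ k.+1]mulr_natl -[_ *+ 2]mulr_natl.
by field; rewrite -?natrS gt_eqF.
Qed.

End Sums.

(** * Partitions as maps to part labels *)

Section Partitions.
Variables (R : realType) (n k : nat).

Lemma kpartition_preimset (f : 'I_n -> 'I_k) :
  kpartition (fun l => [set i | f i == l]%SET).
Proof.
split=> [l m lm|].
  rewrite -setI_eq0; apply/eqP/setP => i; rewrite !inE.
  by apply/negP => /andP[/eqP -> /eqP lmE]; rewrite lmE eqxx in lm.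
by apply/setP => i; rewrite inE; apply/bigcupP; exists (f i); rewrite ?inE.
Qed.

Lemma kpartition_classify (A : 'I_k -> {set 'I_n}) : kpartition A ->
  exists f : 'I_n -> 'I_k, forall i l, (i \in A l) = (f i == l).
Proof.
case=> dA cA.
have /boolp.choice[f fA] (i : 'I_n) : exists l, i \in A l.
  have : i \in (\bigcup_(l < k) A l)%SET by rewrite cA inE.
  by case/bigcupP => l _ il; exists l.
exists f => i l; apply/idP/eqP => [il|<-]; last exact: fA.
apply/eqP/negPn/negP => /dA /pred0P /(_ i) /=.
by rewrite fA il.
Qed.

Lemma cut_classify (G : wgraph R n) (A : 'I_k -> {set 'I_n}) (f : 'I_n -> 'I_k) :
  (forall i l, (i \in A l) = (f i == l)) ->
  cut G A = \sum_(i < n) \sum_(j < n | (i < j)%N) (f i != f j)%:R * weight G i j.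
Proof.
(* Doubles both sides, so that the sums over [l < m] and [i < j] become symmetric sums that can be
   exchanged freely. *)
move=> fA; apply/eqP; rewrite -[_ == _]/((2 == 0)%N || _) -eqrMn2r; apply/eqP.
rewrite sum_lt_symmetric => [|l m]; last first.
  by rewrite exchange_big; do 2!apply: eq_bigr => ? _; rewrite weight_sym.
rewrite sum_lt_symmetric => [|i j]; last by rewrite eq_sym weight_sym.
transitivity (\sum_l \sum_m \sum_i \sum_j
    (l != m)%:R * ((f i == l)%:R * ((f j == m)%:R * weight G i j))).
  apply: eq_bigr => l _; apply: eq_bigr => m _.
  rewrite big_mkcond mulr_sumr; apply: eq_bigr => i _; rewrite fA.
  rewrite -mulr_sumr; congr (_ * _); case: eqP => _; last first.
    by rewrite big1 // => j _; rewrite mul0r.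
  rewrite big_mkcond; apply: eq_bigr => j _; rewrite fA mul1r.
  by case: eqP; rewrite ?mul1r ?mul0r.
under eq_bigr do rewrite exchange_big.
rewrite exchange_big; apply: eq_bigr => i _.
under eq_bigr do rewrite exchange_big.
rewrite exchange_big; apply: eq_bigr => j _.
(* For fixed [i] and [j], only the labels [l = f i] and [m = f j] contribute. *)
rewrite (bigD1 (f i)) //= [X in _ + X]big1 => [|l]; last first.
  by rewrite eq_sym => /negPf fl; apply: big1 => m _; rewrite fl mul0r mulr0.
rewrite addr0 (bigD1 (f j)) //= [X in _ + X]big1 => [|m]; last first.
  by rewrite eq_sym => /negPf fm; rewrite fm mul0r !mulr0.
rewrite addr0 !eqxx !mul1r; have [<-|_] := eqVneq i j; first by rewrite eqxx !mul0r.
by rewrite mul1r.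
Qed.

End Partitions.

(** Gram matrix of unit vectors at the vertices of a regular simplex, one per part: 1 within a part
    and [- k%:R^-1] across parts. There are [k.+1] parts. *)
Definition partition_mx (R : realType) n k (f : 'I_n -> 'I_k.+1) : 'M[R]_n :=
  \matrix_(i, j) ((1 + k%:R^-1) * (f i == f j)%:R - k%:R^-1).

(** * Every cut value is attained by the SDP *)

Section CutToSdp.
Variables (R : realType) (n k : nat) (f : 'I_n -> 'I_k.+1).
Hypothesis k_gt0 : (0 < k)%N.

(** The quadratic form depends only on the sums [s l] of [x] over the parts; after scaling by [k] it
    is the gap in [sqr_sum_le] for [k.+1] terms. *)
Lemma partition_mx_psd : psdmx (partition_mx R f).
Proof.
have k0 : 0 < k%:R :> R by rewrite ltr0n.
split.
  by apply/is_hermitianmxP; rewrite expr0 scale1r map_mx_id //;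
    apply/matrixP => i j; rewrite !mxE eq_sym.
move=> x; rewrite quad_formE.
pose s l := \sum_i (f i == l)%:R * x i 0.
have sumS : \sum_l s l = \sum_i x i 0.
  rewrite exchange_big; apply: eq_bigr => i _ /=.
  rewrite (bigD1 (f i)) //= eqxx mul1r big1 ?addr0 // => l.
  by rewrite eq_sym => /negPf ->; rewrite mul0r.
have sumQ : \sum_l s l ^+ 2 = \sum_i \sum_j x i 0 * x j 0 * (f i == f j)%:R.
  under eq_bigr do rewrite expr2 mulr_suml.
  rewrite exchange_big; apply: eq_bigr => i _ /=.
  rewrite (bigD1 (f i)) //= eqxx mul1r big1 ?addr0 => [|l]; last first.
    by rewrite eq_sym => /negPf ->; rewrite !mul0r.
  by rewrite mulr_sumr; apply: eq_bigr => j _; rewrite eq_sym mulrAC mulrA.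
rewrite (_ : \sum_i _ = (1 + k%:R^-1) * \sum_l s l ^+ 2 -
                        k%:R^-1 * (\sum_l s l) ^+ 2).
  rewrite subr_ge0 -(ler_pM2l k0) !mulrA mulrDr mulfV ?gt_eqF // mulr1 mul1r.
  by rewrite natr1; exact: sqr_sum_le.
rewrite sumQ sumS expr2 mulr_suml !mulr_sumr -sumrB; apply: eq_bigr => i _.
rewrite !mulr_sumr -sumrB; apply: eq_bigr => j _.
by rewrite mxE; ring.
Qed.

Lemma partition_mx_feasible : sdp_feasible k.+1 (partition_mx R f).
Proof.
have k0 : 0 < k%:R :> R by rewrite ltr0n.
split; last exact: partition_mx_psd.
  by move=> i; rewrite mxE eqxx mulr1 addrK.
by move=> i j _; rewrite mxE -natr1 addrK lerDr mulr_ge0.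
Qed.

Lemma partition_mx_objective (G : wgraph R n) :
  sdp_objective k.+1 G (partition_mx R f) =
  \sum_(i < n) \sum_(j < n | (i < j)%N) (f i != f j)%:R * weight G i j.
Proof.
have k0 : k%:R != 0 :> R by rewrite pnatr_eq0 -lt0n.
have k1 : 1 + k%:R != 0 :> R by rewrite addrC natr1 pnatr_eq0.
rewrite /sdp_objective -natr1 addrK mulr_sumr; apply: eq_bigr => i _.
rewrite mulr_sumr; apply: eq_bigr => j _; rewrite mxE.
by case: eqP => _ /=; field; rewrite ?k0 ?k1 // addrC.
Qed.

End CutToSdp.

(** * The SDP bound for a single row of features *)

Section RankOne.
Variables (R : realType) (n m : nat) (X : 'M[R]_n) (I : {set 'I_n}) (a : 'I_n -> R).
Hypothesis m_gt0 : (0 < m)%N.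
Hypothesis X_feas : sdp_feasible m.+1 X.
Hypothesis cardI : #|I| = m.
Hypothesis a_ge0 : forall i, 0 <= a i.
Let s : R := \sum_(j | j \notin I) a j.
Hypothesis a_dom : forall i, i \in I -> s <= a i.

Let Y i j : R := X i j + m%:R^-1.
Let b i : R := if i \in I then s else a i.
(* The diagonal entries at [I] are removed since they have no cut weight. *)
Let Z i j : R := Y i j - ((i == j) && (i \in I))%:R * (1 + m%:R^-1).

Let Z_ge0 i j : 0 <= Z i j.
Proof.
have [Xd Xo _] := X_feas.
rewrite /Z /Y; have [<-|ij] := eqVneq i j; last first.
  by have := Xo _ _ ij; rewrite -natr1 addrK mul0r subr0 -lerBlDr sub0r.
by rewrite Xd; case: (i \in I); rewrite ?mul1r ?mul0r ?subrr // subr0 addr_ge0.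
Qed.

Let s_ge0 : 0 <= s. Proof. exact: sumr_ge0. Qed.

Let b_le i : 0 <= b i <= a i.
Proof. by rewrite /b; case: ifP => [/a_dom ->|_]; rewrite ?s_ge0 ?a_ge0 ?lexx. Qed.

Let sum_b : \sum_i b i = (1 + m%:R) * s.
Proof.
rewrite (bigID (mem I)) /= (eq_bigr (fun=> s)) => [|i Ii]; last by rewrite /b Ii.
rewrite sumr_const cardI (eq_bigr a) => [|i /negPf Ii]; last by rewrite /b Ii.
by rewrite -/s -mulr_natl; ring.
Qed.

(** Since [Z] is nonnegative, [a] may be lowered to [b]. The sum then equals the form [X] at [b],
    plus [(\sum_i b i) ^+ 2 / m], minus the diagonal correction on [I]. *)
Let sum_Z : (1 + m%:R^-1) * s ^+ 2 <= \sum_i \sum_j a i * a j * Z i j.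
Proof.
have m0 : m%:R != 0 :> R by rewrite pnatr_eq0 -lt0n.
apply: (@le_trans _ _ (\sum_i \sum_j b i * b j * Z i j)); last first.
  apply: ler_sum => i _; apply: ler_sum => j _.
  have /andP[bi0 bi] := b_le i; have /andP[bj0 bj] := b_le j.
  by rewrite ler_wpM2r // ler_pM.
have [_ _ [_ /(_ (\col_i b i))]] := X_feas; rewrite quad_formE.
rewrite (_ : \sum_i \sum_j b i * b j * Z i j =
   \sum_i \sum_j (\col_i b i) i 0 * (\col_i b i) j 0 * X i j +
   m%:R^-1 * (\sum_i b i) ^+ 2 - \sum_(i in I) b i ^+ 2 * (1 + m%:R^-1)).
  rewrite [\sum_(i in I) _](eq_bigr (fun=> s ^+ 2 * (1 + m%:R^-1))) => [|i Ii]; last first.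
    by rewrite /b Ii.
  rewrite sum_b sumr_const cardI -addrA => h.
  rewrite -[leLHS]add0r lerD // -mulr_natr.
  (* The constants match exactly: [(1 + m) ^+ 2 / m - (m + 1) = 1 + 1 / m]. *)
  by rewrite le_eqVlt; apply/orP; left; apply/eqP; field.
rewrite expr2 mulr_suml mulr_sumr [\sum_(i in I) _]big_mkcond -big_split -sumrB /=.
apply: eq_bigr => i _.
rewrite mulr_sumr mulr_sumr -big_split /=.
have -> : (if i \in I then b i ^+ 2 * (1 + m%:R^-1) else 0) =
   \sum_j b i * b j * (((i == j) && (i \in I))%:R * (1 + m%:R^-1)).
  rewrite (bigD1 i) //= eqxx big1 ?addr0 => [|j]; last first.
    by rewrite eq_sym => /negPf -> /=; rewrite mul0r mulr0.
  by case: (i \in I); rewrite ?mul0r ?mulr0 ?mul1r ?expr2.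
by rewrite -sumrB; apply: eq_bigr => j _; rewrite /Z /Y !mxE; ring.
Qed.

(** The indicator selects the pairs separated by the cut. Entry by entry, the coefficient is
    [m / (1 + m)] times [Z i j], less [1 + m%:R^-1] when both indices lie outside [I]; the latter
    terms add up to a multiple of [s ^+ 2], so [sum_Z] applies. *)
Lemma rank_one_sdp_le_cut :
  0 <= \sum_i \sum_j a i * a j *
    ((~~ ((i == j) || (i \notin I) && (j \notin I)))%:R -
     m%:R / m.+1%:R * (1 - X i j)).
Proof.
have m0 : m%:R != 0 :> R by rewrite pnatr_eq0 -lt0n.
have m1 : 1 + m%:R != 0 :> R by rewrite addrC natr1 pnatr_eq0.
have [Xd _ _] := X_feas.
rewrite (_ : \sum_i _ = m%:R / (1 + m%:R) *
    (\sum_i \sum_j a i * a j * Z i j - (1 + m%:R^-1) * s ^+ 2)).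
  by rewrite mulr_ge0 ?subr_ge0 // divr_ge0 // addr_ge0.
have -> : s ^+ 2 = \sum_i \sum_j a i * a j * ((i \notin I) && (j \notin I))%:R.
  rewrite expr2 mulr_suml big_mkcond; apply: eq_bigr => i _; case: ifP => _ /=.
    rewrite /s mulr_sumr big_mkcond; apply: eq_bigr => j _.
    by case: ifP; rewrite ?mulr1 ?mulr0.
  by rewrite big1 // => j _; rewrite mulr0.
rewrite mulr_sumr -sumrB mulr_sumr; apply: eq_bigr => i _.
rewrite mulr_sumr -sumrB mulr_sumr; apply: eq_bigr => j _.
rewrite -natr1 /Z /Y; have [<-|_] := eqVneq i j.
  by rewrite Xd; case: (i \in I) => /=; field; rewrite ?m0 ?m1 // addrC.
by case: (i \in I); case: (j \in I) => /=; field; rewrite ?m0 ?m1 // addrC.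
Qed.

End RankOne.

(** * The cut defined by the feature-dominating set *)

Section Dominating.
Variables (R : realType) (n m r : nat) (G : wgraph R n) (F : 'M[R]_(r, n)).
Variable I : {set 'I_n}.
Hypothesis m_gt0 : (0 < m)%N.
Hypothesis F_ge0 : forall p i, 0 <= F p i.
Hypothesis F_feature : feature_matrix G F.
Hypothesis F_dom : feature_dominating m.+1 F I.

(* [index] sends every vertex outside [I] to [#|I| = m], the last part. *)
Definition dominating_part (i : 'I_n) : 'I_m.+1 := inord (index i (enum I)).

Lemma dominating_part_eq i j :
  (dominating_part i == dominating_part j) =
  (i == j) || (i \notin I) && (j \notin I).
Proof.
have [cardI _] := F_dom.
have lt_index x : (index x (enum I) < m.+1)%N.
  by rewrite ltnS -[m]cardI cardE index_size.
rewrite -val_eqE /= !inordK // -!(mem_enum I).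
have [iI|iI] := boolP (i \in enum I).
  rewrite orbF; apply/eqP/eqP => [E|->//].
  by apply: (index_inj i iI _ E); rewrite -index_mem -E index_mem.
have [jI|jI] := boolP (j \in enum I); last first.
  by rewrite orbT !memNindex // eqxx.
rewrite orbF memNindex //; apply/eqP/eqP => [E|ij].
  by rewrite -index_mem -E ltnn in jI.
by rewrite ij jI in iI.
Qed.

Lemma sdp_objective_le_dominating_cut (X : 'M[R]_n) : sdp_feasible m.+1 X ->
  sdp_objective m.+1 G X <= cut G (fun l => [set i | dominating_part i == l]%SET).
Proof.
move=> X_feas; have [cardI domI] := F_dom.
rewrite (@cut_classify _ _ _ G _ dominating_part) => [|i l]; last by rewrite inE.
rewrite -subr_ge0 /sdp_objective -natr1 addrK mulr_sumr -sumrB.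
under eq_bigr do rewrite mulr_sumr -sumrB.
rewrite -(pmulrn_lge0 _ (isT : (0 < 2)%N)) sum_lt_symmetric => [|i j]; last first.
  have [_ _ [/is_hermitianmxP + _]] := X_feas.
  rewrite expr0 scale1r map_mx_id // => XT.
  by rewrite weight_sym eq_sym XT mxE -XT.
pose D i j : R := (~~ ((i == j) || (i \notin I) && (j \notin I)))%:R -
                  m%:R / m.+1%:R * (1 - X i j).
(* Expands each weight over the rows of [F]. On the diagonal, where [F] does not determine the
   weight, both sides vanish because [X i i = 1]. *)
rewrite (_ : \sum_i _ = \sum_p \sum_i \sum_j F p i * F p j * D i j).
  apply: sumr_ge0 => p _; apply: rank_one_sdp_le_cut => // i Ii.
  have := domI i Ii p; rewrite summxE mxE.
  by under eq_bigr do rewrite mxE.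
rewrite [RHS]exchange_big; apply: eq_bigr => i _.
rewrite [RHS]exchange_big; apply: eq_bigr => j _.
rewrite -mulr_suml /D dominating_part_eq natr1.
have [<-|ij] := eqVneq i j.
  by have [Xd _ _] := X_feas; rewrite Xd subrr /= !mulr0 subrr !mul0r mulr0.
rewrite F_feature // mxE.
have -> : \sum_p F p i * F p j = \sum_p (col i F)^T 0 p * col j F p 0.
  by apply: eq_bigr => p _; rewrite !mxE.
by rewrite /=; ring.
Qed.

End Dominating.

Theorem proposition7 (R : realType) (n k r : nat) (hk2 : (2 <= k)%N)
    (hkn : (k < n)%N) (G : wgraph R n) (F : 'M[R]_(r, n))
    (hF0 : forall p i, 0 <= F p i) (hF : feature_matrix G F)
    (hI : exists I : {set 'I_n}, feature_dominating k F I) :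
  sdp_exact k G.
Proof.
case: k hk2 {hkn} hI => // m m_gt0 [I F_dom].
apply/eqP; rewrite eq_le; apply/andP; split.
  (* SDP at most max cut: the one dominating cut bounds every feasible [X]. *)
  apply: ub_ereal_sup => _ [X X_feas <-].
  apply: (@le_trans _ _ (cut G (fun l => [set i | dominating_part m I i == l]%SET))%:E).
    by rewrite lee_fin (sdp_objective_le_dominating_cut (F := F)).
  apply: ereal_sup_ubound; exists (fun l => [set i | dominating_part m I i == l]%SET) => //.
  exact: kpartition_preimset.
(* Conversely, the simplex matrix of any partition is feasible and its objective is the cut. *)
apply: ub_ereal_sup => _ [A /kpartition_classify[f fA] <-].
apply: ereal_sup_ubound; exists (partition_mx R f).
  exact: partition_mx_feasible.
by rewrite partition_mx_objective // (cut_classify G fA).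
Qed.
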